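(* Consider the gas ($g$), electricity ($e$) and heat ($h$) market clearing problem with elementary orders, conversion orders and cumulative constraints: $$\max_x\ \sum_{c\in\{g,e,h\}}\sum_{o\in\mathcal O^c}P_oQ_ox_o-\sum_{co\in\mathcal{CO}}P_{co}^{g\to e}Q_{co}^{g\to eh}x_{co}^{g\to e}-\sum_{co\in\mathcal{CO}}P_{co}^{g\to h}Q_{co}^{g\to eh}x_{co}^{g\to h}$$ subject to $$\sum_{o\in\mathcal O^g}Q_ox_o=-\sum_{co\in\mathcal{CO}}Q_{co}^{g\to eh}x_{co}^{g\to e}-\sum_{co\in\mathcal{CO}}Q_{co}^{g\to eh}x_{co}^{g\to h}\quad[\pi^g],$$ $$\sum_{o\in\mathcal O^e}Q_ox_o=\sum_{co\in\mathcal{CO}}\eta_{co}^{g\to e}Q_{co}^{g\to eh}x_{co}^{g\to e}\quad[\pi^e],\qquad\sum_{o\in\mathcal O^h}Q_ox_o=\sum_{co\in\mathcal{CO}}\eta_{co}^{g\to h}Q_{co}^{g\to eh}x_{co}^{g\to h}\quad[\pi^h],$$ $$x_o\le1\ \ (o\in\mathcal O^g\cup\mathcal O^e\cup\mathcal O^h),\qquad x_{co}^{g\to e}+x_{co}^{g\to h}\le1\ \ (co\in\mathcal{CO}),\qquad x_o,x_{co}^{g\to e},x_{co}^{g\to h}\ge0 .$$ Let $x$ be an optimal solution of this problem and let $\pi^g,\pi^e,\pi^h$ be market prices obtained as optimal dual variables of the three balance constraints. Then for each $co\in\mathcal{CO}$, the values $x_{co}^{g\to e},x_{co}^{g\to h}$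 of this solution are optimal for the profit maximising program of the market participant with a cumulative constraint on these two conversions: $$\max_{x_{co}^{g\to e},\,x_{co}^{g\to h}}\ \big((\eta_{co}^{g\to e}\pi^e-\pi^g)-P_{co}^{g\to e}\big)Q_{co}^{g\to eh}x_{co}^{g\to e}+\big((\eta_{co}^{g\to h}\pi^h-\pi^g)-P_{co}^{g\to h}\big)Q_{co}^{g\to eh}x_{co}^{g\to h}$$ subject to $x_{co}^{g\to e}+x_{co}^{g\to h}\le1$ and $x_{co}^{g\to e},x_{co}^{g\to h}\ge0$.
   Context: For each carrier $c\in\{g,e,h\}$, $\mathcal O^c$ is a finite set of elementary orders (the three sets being disjoint); order $o$ has limit price $P_o\in\mathbb R$, quantity $Q_o\in\mathbb R$ ($<0$ for sell, $>0$ for buy) and acceptance ratio $x_o$. $\mathcal{CO}$ is a finite index set; each $co\in\mathcal{CO}$ stands for one market participant's unit (e.g. an extraction-condensing combined heat and power unit) with total conversion capacity $Q_{co}^{g\to eh}>0$ of input gas, submitting two conversion orders linked by a cumulative constraint: one from gas to electricity with conversion price $P_{co}^{g\to e}$, efficiency $\eta_{co}^{g\to e}>0$ and acceptance ratio $x_{co}^{g\to e}$, and one from gas to heat with conversion price $P_{co}^{g\to h}$, efficiency $\eta_{co}^{g\to h}>0$ and acceptance ratio $x_{co}^{g\to h}$. Sign convention for dual variables: $(\pi^g,\pi^e,\pi^h)$ are optimal dual variables of the balance constraints if they minimise over $\mathbb R^3$ the dual function $\pi\mapsto\max_x\{\text{objective}(x)-\sum_{c}\pi^c(\text{left-hand side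 minus right-hand side of the balance constraint of carrier }c)\}$, the maximum being over $x$ satisfying all constraints other than the balance constraints (equivalently, $\pi$ is the corresponding component of an optimal solution of the linear programming dual). *)

(* Defs.v *)
From mathcomp Require Import all_boot all_order all_algebra.
From mathcomp Require Import all_classical reals.
From mathcomp Require Import ring lra.

Set Implicit Arguments.
Unset Strict Implicit.
Unset Printing Implicit Defensive.

Import Order.TTheory GRing.Theory Num.Theory.

Local Open Scope classical_set_scope.
Local Open Scope ring_scope.

Definition is_maximizer (R : realType) (T : Type) (D : set T) (f : T -> R)
    (x : T) : Prop :=
  D x /\ forall y, D y -> f y <= f x.

Inductive carrier := gas | elec | heat.

(* The order sets are a family of types indexed by the carrier, so that they
   are disjoint by construction. *)
Record market (R : realType) := Market {
  orders : carrier -> finType ;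
  unit_co : finType ;
  price : forall c, orders c -> R ;
  quantity : forall c, orders c -> R ;  (* < 0 for sell, > 0 for buy *)
  price_ge : unit_co -> R ;
  price_gh : unit_co -> R ;
  eff_ge : unit_co -> R ;
  eff_gh : unit_co -> R ;
  capacity : unit_co -> R ;
  quantity_neq0 : forall c (o : orders c), quantity o != 0 ;
  eff_ge_gt0 : forall co, 0 < eff_ge co ;
  eff_gh_gt0 : forall co, 0 < eff_gh co ;
  capacity_gt0 : forall co, 0 < capacity co
}.

Record acceptance (R : realType) (m : market R) := Acceptance {
  acc : forall c, orders m c -> R ;
  acc_ge : unit_co m -> R ;
  acc_gh : unit_co m -> R
}.

Section Clearing.
Variables (R : realType) (m : market R).
Implicit Types (x : acceptance m) (pi : carrier -> R) (co : unit_co m).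

Definition order_welfare c x : R :=
  \sum_(o : orders m c) price o * quantity o * acc x o.

Definition objective x : R :=
  order_welfare gas x + order_welfare elec x + order_welfare heat x
  - \sum_(co : unit_co m) price_ge co * capacity co * acc_ge x co
  - \sum_(co : unit_co m) price_gh co * capacity co * acc_gh x co.

Definition balance_lhs c x : R :=
  \sum_(o : orders m c) quantity o * acc x o.

Definition balance_rhs c x : R :=
  match c with
  | gas => - (\sum_(co : unit_co m) capacity co * acc_ge x co)
           - \sum_(co : unit_co m) capacity co * acc_gh x co
  | elec => \sum_(co : unit_co m) eff_ge co * capacity co * acc_ge x co
  | heat => \sum_(co : unit_co m) eff_gh co * capacity co * acc_gh x co
  end.

Definition balanced x : Prop := forall c, balance_lhs c x = balance_rhs c x.

Definition conversion_feasible : set (R * R) :=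
  [set y | [/\ y.1 + y.2 <= 1, 0 <= y.1 & 0 <= y.2]].

(* All the constraints of the clearing problem except the balances. *)
Definition relaxed_feasible : set (acceptance m) :=
  [set x | (forall c (o : orders m c), 0 <= acc x o <= 1) /\
           (forall co, conversion_feasible (acc_ge x co, acc_gh x co))].

Definition feasible : set (acceptance m) :=
  [set x | relaxed_feasible x /\ balanced x].

Definition is_optimal x : Prop := is_maximizer feasible objective x.

Definition lagrangian pi x : R :=
  objective x
  - (pi gas * (balance_lhs gas x - balance_rhs gas x)
     + pi elec * (balance_lhs elec x - balance_rhs elec x)
     + pi heat * (balance_lhs heat x - balance_rhs heat x)).

(* The supremum is a maximum, see [dual_function_max]. *)
Definition dual_function pi : R :=
  sup [set lagrangian pi x | x in relaxed_feasible].

Definition is_optimal_dual pi : Prop :=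
  forall pi', dual_function pi <= dual_function pi'.

Definition participant_profit pi co (y : R * R) : R :=
  ((eff_ge co * pi elec - pi gas) - price_ge co) * capacity co * y.1
  + ((eff_gh co * pi heat - pi gas) - price_gh co) * capacity co * y.2.

Lemma lagrangianE pi x :
  lagrangian pi x =
  \sum_(o : orders m gas) (price o - pi gas) * quantity o * acc x o
  + \sum_(o : orders m elec) (price o - pi elec) * quantity o * acc x o
  + \sum_(o : orders m heat) (price o - pi heat) * quantity o * acc x o
  + \sum_(co : unit_co m) participant_profit pi co (acc_ge x co, acc_gh x co).
Proof.
have ordE c : \sum_(o : orders m c) (price o - pi c) * quantity o * acc x o
            = order_welfare c x - pi c * balance_lhs c x.
  rewrite /order_welfare /balance_lhs mulr_sumr -sumrB.
  by apply: eq_bigr => o _; ring.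
have coE : \sum_(co : unit_co m)
      participant_profit pi co (acc_ge x co, acc_gh x co)
    = pi gas * balance_rhs gas x + pi elec * balance_rhs elec x
      + pi heat * balance_rhs heat x
      - \sum_(co : unit_co m) price_ge co * capacity co * acc_ge x co
      - \sum_(co : unit_co m) price_gh co * capacity co * acc_gh x co.
  rewrite /balance_rhs mulrBr mulrN !mulr_sumr -!sumrN -!big_split /=.
  by apply: eq_bigr => co _; rewrite /participant_profit /=; ring.
by rewrite !ordE coE /lagrangian /objective; ring.
Qed.

Lemma lagrangian_has_maximizer pi :
  exists x, is_maximizer relaxed_feasible (lagrangian pi) x.
Proof.
pose a co := ((eff_ge co * pi elec - pi gas) - price_ge co) * capacity co.
pose b co := ((eff_gh co * pi heat - pi gas) - price_gh co) * capacity co.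
pose x : acceptance m := Acceptance
  (fun c (o : orders m c) => (0 <= (price o - pi c) * quantity o)%R%:R)
  (fun co => ((0 <= a co) && (b co <= a co))%R%:R)
  (fun co => ((0 <= b co) && (a co < b co))%R%:R).
exists x; split.
  split=> [c o|co] /=; first by case: (0 <= _ * quantity o); rewrite ?lexx ?ler01.
  by split=> /=; case: (lerP (b co) (a co)); case: (0 <= a co);
    case: (0 <= b co); rewrite /= ?mulr1n ?mulr0n ?addr0 ?add0r ?lexx ?ler01.
move=> y [yo yco]; rewrite !lagrangianE.
have ordP c : \sum_(o : orders m c) (price o - pi c) * quantity o * acc y o
           <= \sum_(o : orders m c) (price o - pi c) * quantity o * acc x o.
  apply: ler_sum => o _ /=; have /andP[y0 y1] := yo c o.
  by case: (lerP 0 ((price o - pi c) * quantity o)) => h /=; nra.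
apply: lerD; first by rewrite !lerD.
apply: ler_sum => co _; have [/= y1 y2 y3] := yco co.
rewrite /participant_profit /= -/(a co) -/(b co).
case: (lerP 0 (a co)) => ha; case: (lerP 0 (b co)) => hb;
  case: (lerP (b co) (a co)) => hab /=; nra.
Qed.

Lemma dual_function_max pi x :
  is_maximizer relaxed_feasible (lagrangian pi) x ->
  dual_function pi = lagrangian pi x.
Proof.
move=> [Dx maxx]; apply/eqP; rewrite eq_le; apply/andP; split.
  by apply: ge_sup => [|_ [y Dy <-]]; [exists (lagrangian pi x), x | exact: maxx].
apply: ub_le_sup; last by exists x.
by exists (lagrangian pi x) => _ [y Dy <-]; exact: maxx.
Qed.

End Clearing.

(* Main.v *)
(* The Lagrangian splits over orders and units once the prices are fixed, so it
   suffices that [x] maximizes it, i.e. that there is no duality gap. Strong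
   duality follows from Farkas' lemma applied to the homogenized clearing
   problem, whose variables are the acceptances together with a scale [s >= 0]
   replacing the bound 1. *)
Require Import Defs.
From HB Require Import structures.
From mathcomp Require Import all_boot all_order all_algebra.
From mathcomp Require Import all_classical reals.
From mathcomp Require Import ring.

Set Implicit Arguments.
Unset Strict Implicit.
Unset Printing Implicit Defensive.

Import Order.TTheory GRing.Theory Num.Theory.

Local Open Scope ring_scope.

(** * Farkas' lemma and multipliers for systems of linear forms *)

Definition linear_form (R : pzRingType) (V : lmodType R) (f : V -> R)
    (f_scalar : scalar f) : {scalar V} :=
  HB.pack f (GRing.isLinear.Build R V R *%R f f_scalar).

(* Bartl's induction: if dropping the first inequality breaks the implication at
   [w], project the others along [w] onto the kernel of the first. *)
Lemma farkas_ord (R : realFieldType) (V : lmodType R) (n : nat)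
    (a : 'I_n -> {scalar V}) (b : {scalar V}) :
    (forall v, (forall i, a i v <= 0) -> b v <= 0) ->
  exists2 u : 'I_n -> R, forall i, 0 <= u i &
    forall v, b v = \sum_i u i * a i v.
Proof.
elim: n a b => [|n IHn] a b hab.
  have b0 v : b v <= 0 by apply: hab => -[].
  exists (fun=> 0) => // v; apply/eqP.
  by rewrite big_ord0 eq_le b0 -oppr_le0 -linearN b0.
pose a1 := a ord0; pose a' i := a (lift ord0 i).
have [hb|/existsNP[w /not_implyP[a'w /negP]]] :=
  pselect (forall v, (forall i, a' i v <= 0) -> b v <= 0).
  (* The first inequality is redundant here, so it gets multiplier 0. *)
  have [u u0 bE] := IHn a' b hb.
  exists (fun i => oapp u 0 (unlift ord0 i)) => [i|v].
    by case: (unlift ord0 i) => [j|] /=.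
  rewrite big_ord_recl unlift_none mul0r add0r bE.
  by apply: eq_bigr => i _; rewrite liftK.
rewrite -ltNge => bw.
(* Otherwise [w] would satisfy all the inequalities and still have [b w > 0]. *)
have a1w : 0 < a1 w.
  rewrite ltNge; apply/negP => a1w; move: bw; rewrite ltNge hab // => i.
  by case: (unliftP ord0 i) => [j|] -> //; exact: a'w.
have proj_scalar (f : {scalar V}) : scalar (fun v => f v - f w / a1 w * a1 v).
  by move=> k v v'; rewrite !linearP /=; ring.
pose proj f := linear_form (proj_scalar f).
have projE f v : proj f v = f (v - (a1 v / a1 w) *: w).
  by rewrite linearB linearZ /=; field; rewrite gt_eqF.
have [v hv|u u0 bE] := IHn (fun i => proj (a' i)) (proj b).
  rewrite projE; apply: hab => i; case: (unliftP ord0 i) => [j|] ->.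
    by have := hv j; rewrite projE.
  by rewrite -/a1 linearB linearZ /= mulfVK ?gt_eqF ?subrr ?lexx.
(* Expanding the identity between projected forms, [k] is what the coefficients of [a1 v] add up to.
   It is nonnegative because [b w > 0] while every [a' i w <= 0]. *)
pose k := (b w - \sum_i u i * a' i w) / a1 w.
have k0 : 0 <= k.
  apply: divr_ge0 (ltW a1w); rewrite subr_ge0 (le_trans _ (ltW bw)) //.
  by apply: sumr_le0 => i _; rewrite mulr_ge0_le0.
exists (fun i => oapp u k (unlift ord0 i)) => [i|v].
  by case: (unlift ord0 i) => [j|] /=.
rewrite big_ord_recl unlift_none /= -/a1.
under eq_bigr => i _ do rewrite liftK /= -/(a' i).
have /= /eqP := bE v; rewrite subr_eq => /eqP ->.
under eq_bigr => i _ do rewrite mulrBr !mulrA.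
by rewrite sumrB -!mulr_suml /k; ring.
Qed.

Lemma farkas (R : realFieldType) (V : lmodType R) (I : finType)
    (a : I -> {scalar V}) (b : {scalar V}) :
    (forall v, (forall i, a i v <= 0) -> b v <= 0) ->
  exists2 u : I -> R, forall i, 0 <= u i & forall v, b v = \sum_i u i * a i v.
Proof.
move=> hab; have [v hv|u u0 bE] := @farkas_ord R V #|I| (a \o enum_val) b.
  by apply: hab => i; rewrite -(enum_rankK i) hv.
exists (u \o enum_rank) => [i|v]; first exact: u0.
rewrite bE (reindex_onto enum_rank enum_val) => [|i _]; last exact: enum_valK.
apply: eq_big => [i|i _] /=; first by rewrite enum_rankK eqxx.
by rewrite enum_rankK.
Qed.

Lemma lagrange_multipliers (R : realFieldType) (V : lmodType R) (I J : finType)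
    (a : I -> {scalar V}) (e : J -> {scalar V}) (b : {scalar V}) :
    (forall v, (forall i, a i v <= 0) -> (forall j, e j v = 0) -> b v <= 0) ->
  exists p : J -> R, forall v, (forall i, a i v <= 0) ->
    b v <= \sum_j p j * e j v.
Proof.
move=> hab.
pose f (k : I + (J + J)) : {scalar V} := match k with
  | inl i => a i | inr (inl j) => e j | inr (inr j) => \- e j end.
have [v hv|u u0 bE] := @farkas R V _ f b.
  apply: hab => [i|j]; first exact: (hv (inl i)).
  apply/eqP; rewrite eq_le (hv (inr (inl j))) /= -oppr_le0.
  exact: (hv (inr (inr j))).
exists (fun j => u (inr (inl j)) - u (inr (inr j))) => v av.
rewrite bE !big_sumType /=.
under [leRHS]eq_bigr => j _ do rewrite mulrBl -mulrN.
rewrite big_split /= gerDr.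
by apply: sumr_le0 => i _; rewrite mulr_ge0_le0.
Qed.

(** * Carriers as a finite type, to index the balance equations *)

Definition nat_of_carrier c := match c with gas => 0%N | elec => 1%N | heat => 2 end.
Definition carrier_of_nat n := match n with 0%N => gas | 1%N => elec | _ => heat end.

Lemma nat_of_carrierK : cancel nat_of_carrier carrier_of_nat.
Proof. by case. Qed.

HB.instance Definition _ := Countable.copy carrier (can_type nat_of_carrierK).

Lemma carrier_enumP : Finite.axiom [:: gas; elec; heat].
Proof. by case. Qed.

HB.instance Definition _ := isFinite.Build carrier carrier_enumP.

Lemma sum_carrier (R : nmodType) (F : carrier -> R) :
  \sum_c F c = F gas + F elec + F heat.
Proof.
rewrite (bigD1 gas) // (bigD1 elec) //= (bigD1 heat) //= big1 ?addr0 ?addrA //.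
by case.
Qed.

(** * Strong duality through the homogenized clearing problem *)

Section StrongDuality.
Variables (R : realType) (m : market R).
Implicit Types (x : acceptance m) (pi : carrier -> R).

(** The last component is the scale. Acceptances are repacked as functions into [R^o] because linear
    forms need a module, which the record [acceptance] is not. *)
Let V : lmodType R :=
  (({c & orders m c} -> R^o) * ((unit_co m -> R^o) * (unit_co m -> R^o)) * R^o)%type.

Definition acceptance_of (v : V) : acceptance m :=
  Acceptance (fun c (o : orders m c) => v.1.1 (Tagged (orders m) o))
    v.1.2.1 v.1.2.2.

Definition vector_of x (s : R) : V :=
  ((fun o => acc x (tagged o), (acc_ge x, acc_gh x)), s).

Lemma sum_mul_linear (T : finType) (k : R) (w f g : T -> R) :
  \sum_i w i * (k * f i + g i) = k * (\sum_i w i * f i) + \sum_i w i * g i.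
Proof. by rewrite mulr_sumr -big_split; apply: eq_bigr => i _ /=; ring. Qed.

Definition imbalance c x : R := balance_lhs c x - balance_rhs c x.

(** With [z] the optimal value, this is the form that Farkas' lemma has to bound by 0: the constant
    [z] is multiplied by the scale to make it homogeneous. *)
Lemma objective_scalar (z : R) :
  scalar (fun v : V => objective (acceptance_of v) - v.2 * z).
Proof.
move=> k u v; rewrite /objective /order_welfare /acceptance_of /=.
by rewrite !sum_mul_linear /GRing.scale /=; ring.
Qed.

Lemma imbalance_scalar c :
  scalar (fun v : V => imbalance c (acceptance_of v)).
Proof.
move=> k u v; case: c; rewrite /imbalance /balance_lhs /balance_rhs /=;
  by rewrite !sum_mul_linear; ring.
Qed.

(** Replacing the bound 1 by [v.2] turns the constraints into a cone. The sum type collects them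
    under a single finite index. *)
Definition bound (k : unit + bool * {c & orders m c} + option bool * unit_co m)
    (v : V) : R :=
  match k with
  | inl (inl _) => - v.2
  | inl (inr (true, o)) => - v.1.1 o
  | inl (inr (false, o)) => v.1.1 o - v.2
  | inr (Some true, co) => - v.1.2.1 co
  | inr (Some false, co) => - v.1.2.2 co
  | inr (None, co) => v.1.2.1 co + v.1.2.2 co - v.2
  end.

Lemma bound_scalar k : scalar (bound k).
Proof.
by move=> t u v; move: k => [[?|[[] ?]]|[[[]|] ?]];
  rewrite /bound /= ?fctE /GRing.scale /=; ring.
Qed.

Lemma boundP v : (forall k, bound k v <= 0) <->
  [/\ 0 <= v.2, forall o, 0 <= v.1.1 o <= v.2 &
      forall co, [/\ v.1.2.1 co + v.1.2.2 co <= v.2, 0 <= v.1.2.1 co &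
                     0 <= v.1.2.2 co]].
Proof.
split=> [h|[v2 vo vco] [[_|[[] o]]|[[[]|] co]] /=].
- split=> [|o|co]; first by have /= := h (inl (inl tt)); rewrite oppr_le0.
    have /= := h (inl (inr (true, o))); have /= := h (inl (inr (false, o))).
    by rewrite oppr_le0 subr_le0 => -> ->.
  have /= := h (inr (Some true, co)); have /= := h (inr (Some false, co)).
  by have /= := h (inr (None, co)); rewrite !oppr_le0 subr_le0.
- by rewrite oppr_le0.
- by rewrite oppr_le0; case/andP: (vo o).
- by rewrite subr_le0; case/andP: (vo o).
- by rewrite oppr_le0; case: (vco co).
- by rewrite oppr_le0; case: (vco co).
- by rewrite subr_le0; case: (vco co).
Qed.

Lemma acceptance_of_vector x s : acceptance_of (vector_of x s) = x.
Proof. by case: x. Qed.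

Lemma bound_vector x :
  relaxed_feasible x -> forall k, bound k (vector_of x 1) <= 0.
Proof. by move=> [xo xco]; apply/boundP; split=> //= o; exact: xo. Qed.

Lemma bound_relaxed v :
  v.2 = 1 -> (forall k, bound k v <= 0) -> relaxed_feasible (acceptance_of v).
Proof.
move=> v1 /boundP[_ vo vco].
split=> [c o|co]; rewrite /conversion_feasible /= -v1; first exact: vo.
exact: vco.
Qed.

Lemma lagrangianE_imbalance pi x :
  lagrangian pi x = objective x - \sum_c pi c * imbalance c x.
Proof. by rewrite sum_carrier. Qed.

(** The prices are the multipliers of the balance equations in the homogenized problem; at scale 1
    their inequality is the claimed bound. *)
Lemma strong_duality x : is_optimal x ->
  exists pi, forall y : acceptance m,
    relaxed_feasible y -> lagrangian pi y <= objective x.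
Proof.
move=> [[Dx bx] xmax].
pose a k := linear_form (bound_scalar k).
pose e c := linear_form (imbalance_scalar c).
pose b := linear_form (objective_scalar (objective x)).
pose vx := vector_of x 1.
have bvx : b vx = 0 by rewrite /b /= acceptance_of_vector mul1r subrr.
have evx c : e c vx = 0.
  by rewrite /e /= acceptance_of_vector /imbalance bx subrr.
have [v av ev|pi hpi] := @lagrange_multipliers R V _ _ a e b.
  (* Adding [vx] makes the scale positive, so that dividing by it is possible. *)
  have v2 : 0 < 1 + v.2 by have /boundP[v2 _ _] := av; rewrite ltr_pwDl.
  pose w := (1 + v.2)^-1 *: (vx + v).
  have w2 : w.2 = 1 by rewrite /w /= /GRing.scale /= mulVf ?gt_eqF.
  have Dw : feasible (acceptance_of w).
    split.
      apply: bound_relaxed => // k; rewrite -[bound k w]/(a k w) linearZ /=.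
      rewrite pmulr_rle0 ?invr_gt0 // -[bound k _]/(a k _) linearD /=.
      by rewrite -[leRHS]addr0 lerD ?bound_vector //; exact: av.
    move=> c; apply/eqP; rewrite -subr_eq0 -[_ - _]/(e c w) linearZ linearD.
    by rewrite evx ev addr0 /= mulr0.
  have : b w <= 0.
    rewrite -[b w]/(objective (acceptance_of w) - w.2 * objective x).
    by rewrite w2 mul1r subr_le0; exact: xmax.
  by rewrite linearZ linearD bvx add0r /= pmulr_rle0 ?invr_gt0.
exists pi => y Dy; have := hpi (vector_of y 1) (bound_vector Dy).
rewrite lagrangianE_imbalance /b /= acceptance_of_vector mul1r.
by rewrite lerBlDr -lerBlDl.
Qed.

End StrongDuality.

Theorem proposition4 (R : realType) (m : market R) (x : acceptance m)
    (pi : carrier -> R)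
    (x_opt : is_optimal x) (pi_opt : is_optimal_dual m pi)
    (co : unit_co m) :
  is_maximizer (@conversion_feasible R) (participant_profit pi co)
    (acc_ge x co, acc_gh x co).
Proof.
have [[[xo xco] bx] _] := x_opt.
split=> [|y Dy]; first exact: xco.
have [pi' hpi'] := strong_duality x_opt.
have [z /[dup] zmax [Dz _]] := lagrangian_has_maximizer m pi'.
have [z' /[dup] z'max [_ hz']] := lagrangian_has_maximizer m pi.
(* The Lagrangian at [u] is at most the dual value at [pi], hence at most that at [pi'], hence at
   most [objective x], which equals the Lagrangian at [x] since [x] is balanced. *)
have xmax (u : acceptance m) :
    relaxed_feasible u -> lagrangian pi u <= lagrangian pi x.
  move=> Du; apply: (le_trans (hz' _ Du)).
  rewrite -(dual_function_max z'max) (le_trans (pi_opt pi')) //.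
  rewrite (dual_function_max zmax) (le_trans (hpi' _ Dz)) //.
  by rewrite lagrangianE_imbalance big1 ?subr0 // => c _;
    rewrite /imbalance bx subrr mulr0.
(* Deviating at [co] alone leaves every other term of the split Lagrangian unchanged, so only the
   profit of [co] is compared. *)
pose x' := Acceptance (@acc _ _ x)
  (fun i => if i == co then y.1 else acc_ge x i)
  (fun i => if i == co then y.2 else acc_gh x i).
have /xmax : relaxed_feasible x'.
  by split=> //= i; case: eqP => // _; case: y Dy.
rewrite !lagrangianE lerD2l (bigD1 co) //= [leRHS](bigD1 co) //= eqxx.
under eq_bigr => i /negPf ico do rewrite ico.
by rewrite lerD2r; case: y Dy {x'}.
Qed.
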